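(* Let $G_A$ be the graph of the map of the contiguous 48 states of the USA: its vertices are the 48 states (all states except Alaska and Hawaii; the District of Columbia is not a vertex), and two states are adjacent if they share a border of positive length; it has 105 edges, listed explicitly in the context. Then the number of proper colorings of $G_A$ with $4$ colors is $$\chi(G_A,4)=12{,}811{,}591{,}729{,}152.$$
   Context: For a finite simple graph $G$ and a positive integer $t$, $\chi(G,t)$ denotes the number of maps $f:V(G)\to C$, where $C$ is a fixed set of $t$ colors, with $f(u)\neq f(v)$ whenever $\{u,v\}$ is an edge of $G$ (proper colorings, not counted up to any symmetry). States meeting only at a corner (such as Arizona and Colorado) are not adjacent. Using postal abbreviations, the 105 edges of $G_A$ are as follows, each edge listed once in the form ''state: neighbors''. AL: FL, GA, MS, TN. AZ: CA, NV, NM, UT. AR: LA, MS, MO, OK, TN, TX. CA: NV, OR. CO: KS, NE, NM, OK, UT, WY. CT: MA, NY, RI. DE: MD, NJ, PA. FL: GA. GA: NC, SC, TN. ID: MT, NV, OR, UT, WA, WY. IL: IN, IA, KY, MO, WI. IN: KY, MI, OH. IA: MN, MO, NE, SD, WI. KS: MO, NE, OK. KY: MO, OH, TN, VA, WV. LA: MS, TX. ME: NH. MD: PA, VA, WV. MA: NH, NY, RI, VT. MI: OH, WI. MN: ND, SD, WI. MS: TN. MO: NE, OK, TN. MT: ND, SD, WY. NE: SD, WY. NV: OR, UT. NH: VT. NJ: NY, PA. NM: OK, TX. NY: PA, VT. NC: SC, TN, VA. ND: SD. OH: PA, WV. OK: TX. OR: WA. PA: WV. SD: WY. TN: VA. UT: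 WY. VA: WV. *)

(* Defs.v *)
From HB Require Import structures.
From mathcomp Require Import all_boot.

Set Implicit Arguments.
Unset Strict Implicit.
Unset Printing Implicit Defensive.

Record sgraph := SGraph {
  vertex :> finType;
  adj : rel vertex;
  adj_sym : symmetric adj;
  adj_irrefl : irreflexive adj }.

Definition edges (G : sgraph) : {set {set G}} :=
  [set [set p.1; p.2] | p : G * G & adj p.1 p.2].

Definition proper_coloring (G : sgraph) (t : nat) (f : {ffun G -> 'I_t}) : bool :=
  [forall u, forall v, adj u v ==> (f u != f v)].

Definition num_colorings (G : sgraph) (t : nat) : nat :=
  #|[set f : {ffun G -> 'I_t} | proper_coloring f]|.

(* The 48 contiguous states of the USA, by postal abbreviation. *)
Inductive state : predArgType :=
  | AL | AZ | AR | CA | CO | CT | DE | FL | GA | ID | IL | IN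
  | IA | KS | KY | LA | ME | MD | MA | MI | MN | MS | MO | MT
  | NE | NV | NH | NJ | NM | NY | NC | ND | OH | OK | OR | PA
  | RI | SC | SD | TN | TX | UT | VT | VA | WA | WV | WI | WY.

Definition states : seq state :=
  [:: AL; AZ; AR; CA; CO; CT; DE; FL; GA; ID; IL; IN;
      IA; KS; KY; LA; ME; MD; MA; MI; MN; MS; MO; MT;
      NE; NV; NH; NJ; NM; NY; NC; ND; OH; OK; OR; PA;
      RI; SC; SD; TN; TX; UT; VT; VA; WA; WV; WI; WY].

Scheme Boolean Equality for state.

Lemma statesK : pcancel (fun u => find (state_beq u) states) (onth states).
Proof. by case. Qed.

HB.instance Definition _ := PCanIsCountable statesK.

Lemma states_enum : Finite.axiom states.
Proof. by case. Qed.

HB.instance Definition _ := isFinite.Build state states_enum.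

(* Each border of positive length is listed once, at only one of its two
   states; corner contacts (AZ-CO, NM-UT) do not count. *)
Definition neighbors (u : state) : seq state :=
  match u with
  | AL => [:: FL; GA; MS; TN]
  | AZ => [:: CA; NV; NM; UT]
  | AR => [:: LA; MS; MO; OK; TN; TX]
  | CA => [:: NV; OR]
  | CO => [:: KS; NE; NM; OK; UT; WY]
  | CT => [:: MA; NY; RI]
  | DE => [:: MD; NJ; PA]
  | FL => [:: GA]
  | GA => [:: NC; SC; TN]
  | ID => [:: MT; NV; OR; UT; WA; WY]
  | IL => [:: IN; IA; KY; MO; WI]
  | IN => [:: KY; MI; OH]
  | IA => [:: MN; MO; NE; SD; WI]
  | KS => [:: MO; NE; OK]
  | KY => [:: MO; OH; TN; VA; WV]
  | LA => [:: MS; TX]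
  | ME => [:: NH]
  | MD => [:: PA; VA; WV]
  | MA => [:: NH; NY; RI; VT]
  | MI => [:: OH; WI]
  | MN => [:: ND; SD; WI]
  | MS => [:: TN]
  | MO => [:: NE; OK; TN]
  | MT => [:: ND; SD; WY]
  | NE => [:: SD; WY]
  | NV => [:: OR; UT]
  | NH => [:: VT]
  | NJ => [:: NY; PA]
  | NM => [:: OK; TX]
  | NY => [:: PA; VT]
  | NC => [:: SC; TN; VA]
  | ND => [:: SD]
  | OH => [:: PA; WV]
  | OK => [:: TX]
  | OR => [:: WA]
  | PA => [:: WV]
  | SD => [:: WY]
  | TN => [:: VA]
  | UT => [:: WY]
  | VA => [:: WV]
  | _ => [::]
  end.

Definition share_border : rel state :=
  fun u v => (v \in neighbors u) || (u \in neighbors v).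

Lemma share_border_sym : symmetric share_border.
Proof. by move=> u v; rewrite /share_border orbC. Qed.

Lemma share_border_irrefl : irreflexive share_border.
Proof. by case. Qed.

Definition G_A : sgraph := SGraph share_border_sym share_border_irrefl.

Lemma card_G_A : #|G_A| = 48.
Proof. by rewrite cardT enumT unlock. Qed.

Lemma card_edges_G_A : #|edges G_A| = 105.
Proof.
pose L : seq (state * state) := [seq (u, v) | u <- states, v <- neighbors u].
have LP p : (p \in L) = (p.2 \in neighbors p.1).
  case: p => u v; apply/allpairsPdep/idP => [[x [y [_ yx [-> ->]]]] //|uv].
  by exists u, v; split=> //; case: (u).
have Lasym : all (fun p => (p.2, p.1) \notin L) L by vm_compute.
have Lanti u v : (u, v) \in L -> (v, u) \notin L by move/(allP Lasym).
have Luniq : uniq L by vm_compute.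
have Lsize : size L = 105 by vm_compute.
clearbody L.
have -> : edges G_A = [set [set p.1; p.2] | p in [set p in L]] :> {set {set state}}.
  apply/setP=> A; apply/imsetP/imsetP => -[[u v] /=]; rewrite inE => uv ->.
  - case/orP: uv => uv; first by exists (u, v); rewrite // inE LP.
    by exists (v, u); [rewrite inE LP | rewrite setUC].
  - by exists (u, v); rewrite // inE /= /share_border -(LP (u, v)) uv.
rewrite card_in_imset ?cardsE ?(card_uniqP Luniq) // => -[u v] [x y].
rewrite !inE /= => uvL xyL /setP uvxy.
have uNv : u != v by apply: contraTneq (uvL) => uv; move: (Lanti _ _ uvL); rewrite uv.
have := uvxy u; have := uvxy v; rewrite !inE !eqxx ?orbT /=.
move=> /esym/orP[]/eqP v_ /esym/orP[]/eqP u_; subst=> //.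
- by rewrite eqxx in uNv.
- by move: (Lanti _ _ uvL); rewrite xyL.
- by rewrite eqxx in uNv.
Qed.

(* Main.v *)
(** Vertices are coloured one at a time. The number of ways to complete a partial
    colouring depends only on the colours of its frontier, the coloured vertices
    that still have an uncoloured neighbour. Sweeping the map from California to
    Maine keeps the frontier at 6 states or fewer, so that tabulating the number of
    completions over all colourings of each frontier makes the count a computation. *)

Require Import Defs.
From Stdlib Require Import BinNat.
From mathcomp Require Import all_boot.

Set Implicit Arguments.
Unset Strict Implicit.
Unset Printing Implicit Defensive.

(** A trie keyed by lists of colours. The entries are binary numbers, because the counts are far too
    large for unary arithmetic. *)
Inductive table := Value of N | Branch of seq table.

Fixpoint tabulate (t n : nat) (h : seq nat -> N) : table :=
  if n is n'.+1 then
    Branch [seq tabulate t n' (fun k => h (c :: k)) | c <- iota 0 t]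
  else Value (h [::]).

Fixpoint lookup (T : table) (k : seq nat) : N :=
  match T, k with
  | Value x, _ => x
  | Branch s, c :: k' => lookup (nth (Value 0) s c) k'
  | Branch _, [::] => 0%num
  end.

Lemma lookup_tabulate t n h k :
  size k = n -> all (ltn^~ t) k -> lookup (tabulate t n h) k = h k.
Proof.
elim: n h k => [|n IHn] h [|c k] //= [sk] /andP[ct kt].
by rewrite (nth_map 0) ?size_iota // nth_iota // IHn.
Qed.

Lemma nat_of_bin_add (m n : N) : nat_of_bin (N.add m n) = nat_of_bin m + nat_of_bin n.
Proof. by case: m n => [|p] [|q] //=; rewrite ?addn0 // nat_of_add_pos. Qed.

Lemma nat_of_foldr_add (p : pred nat) (h : nat -> N) s :
  nat_of_bin (foldr (fun c x => if p c then x else N.add (h c) x) 0%num s) =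
  \sum_(c <- s) if p c then 0 else nat_of_bin (h c).
Proof.
elim: s => [|c s IHs] /=; first by rewrite big_nil.
by rewrite big_cons -IHs; case: ifP => // _; rewrite nat_of_bin_add.
Qed.

Section Completions.

Variables (G : sgraph) (t : nat).
Implicit Types (g : G -> 'I_t) (r F : seq G) (u v : G).

(** Only edges with an endpoint in [r] are tested, so conflicts of [g] among coloured vertices are
    ignored; this makes the frontier colours sufficient. *)
Definition completions g r : {set {ffun G -> 'I_t}} :=
  [set f : {ffun G -> 'I_t} | [forall x, (x \notin r) ==> (f x == g x)] &&
    [forall u, (u \in r) ==> [forall v, adj u v ==> (f u != f v)]]].

Lemma completionsP g r (f : {ffun G -> 'I_t}) :
  reflect ((forall x, x \notin r -> f x = g x) /\
           (forall u v, u \in r -> adj u v -> f u != f v))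
          (f \in completions g r).
Proof.
rewrite inE; apply: (iffP andP) => -[fg fP]; split.
- by move=> x xr; apply/eqP; move/forallP/(_ x)/implyP: fg; apply.
- move=> u v ur uv; move/forallP/(_ u)/implyP/(_ ur)/forallP/(_ v)/implyP: fP.
  exact.
- by apply/forallP=> x; apply/implyP=> /fg ->.
- by apply/forallP=> u; apply/implyP=> ur; apply/forallP=> v; apply/implyP; apply: fP.
Qed.

Lemma card_completions_nil g : #|completions g [::]| = 1.
Proof.
suff -> : completions g [::] = [set finfun g] by rewrite cards1.
apply/setP=> f; rewrite [RHS]inE; apply/completionsP/eqP => [[fg _]|->].
  by apply/ffunP=> x; rewrite fg // ffunE.
by split=> // x _; rewrite ffunE.
Qed.

Definition recolor g v (c : 'I_t) : G -> 'I_t := fun x => if x == v then c else g x.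

(** Sort the completions by the colour of [v]: one already held by a coloured neighbour allows none,
    and any other settles every edge from [v] to a coloured vertex. *)
Lemma card_completions_cons g v r : v \notin r ->
  #|completions g (v :: r)| =
  \sum_(c < t) if [exists u, [&& u \notin v :: r, adj v u & g u == c]] then 0
               else #|completions (recolor g v c) r|.
Proof.
move=> vr; rewrite -sum1_card (partition_big (fun f : {ffun G -> 'I_t} => f v) predT) //=.
apply: eq_bigr => c _; case: existsP => [[u /and3P[ur vu /eqP gu]]|free].
  rewrite big_pred0 // => f; apply/negP=> /andP[/completionsP[fg fP] /eqP fv].
  by have := fP v u (mem_head _ _) vu; rewrite fv (fg _ ur) gu eqxx.
rewrite -sum1_card; apply: eq_bigl => f.
apply/andP/completionsP => [[/completionsP[fg fP] /eqP fv]|[fg fP]].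
  split=> [x xr|x y xr]; last by apply: fP; rewrite inE xr orbT.
  rewrite /recolor; case: eqP => [->//|/eqP xv].
  by apply: fg; rewrite inE negb_or xv.
have fv : f v = c by rewrite fg // /recolor eqxx.
have fg' x : x \notin v :: r -> f x = g x.
  by rewrite inE negb_or => /andP[xv xr]; rewrite fg // /recolor (negPf xv).
split; last exact/eqP.
apply/completionsP; split=> // x y; rewrite inE => /predU1P[->{x} vy|xr]; last exact: fP.
have [|yr] := boolP (y \in v :: r); last first.
  rewrite fv fg' //; apply/eqP=> cg; case: free; exists y.
  by rewrite yr vy -cg eqxx.
rewrite inE => /predU1P[yv|yr]; first by rewrite yv adj_irrefl in vy.
by rewrite eq_sym fP // adj_sym.
Qed.

(* [F] is the frontier, [r] lists the uncoloured vertices and the argument [k] gives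
   the colours of [F]. The table is bound outside [fun k] so that it is built only once. *)
Fixpoint count_completions (F r : seq G) : seq nat -> N :=
  if r is v :: r' then
    let keep := [seq has (adj u) r' | u <- v :: F] in
    let nbr := [seq adj v u | u <- F] in
    let F' := mask keep (v :: F) in
    let T := tabulate t (size F') (count_completions F' r') in
    fun k => foldr (fun c s => if c \in mask nbr k then s
                               else N.add (lookup T (mask keep (c :: k))) s)
                   0%num (iota 0 t)
  else fun=> 1%num.

(** The last hypothesis says that [F] misses no frontier vertex; extra coloured vertices in [F] are
    harmless. *)
Lemma count_completionsE F r g : uniq r -> {in F, forall u, u \notin r} ->
    (forall u v, u \notin r -> v \in r -> adj u v -> u \in F) ->
  nat_of_bin (count_completions F r [seq val (g u) | u <- F]) = #|completions g r|.
Proof.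
elim: r F g => [|v r IHr] F g; first by rewrite card_completions_nil.
move=> /andP[vr Ur] Fr rF; rewrite card_completions_cons //.
pose keep := [seq has (adj u) r | u <- v :: F].
pose T := tabulate t _ (count_completions (mask keep (v :: F)) r).
set k := map _ F.
rewrite (nat_of_foldr_add (fun c => c \in mask [seq adj v u | u <- F] k)
           (fun c => lookup (T _) (mask keep (c :: k)))) {}/k.
rewrite -[in iota 0 t](subn0 t) -/(index_iota 0 t) big_mkord; apply: eq_bigr => c _.
(* Every coloured neighbour of [v] lies in [F], so scanning [F] finds all forbidden colours. *)
have -> : (val c \in mask [seq adj v u | u <- F] [seq val (g u) | u <- F]) =
          [exists u, [&& u \notin v :: r, adj v u & g u == c]].
  rewrite -map_mask -filter_mask; apply/mapP/existsP.
    case=> u; rewrite mem_filter => /andP[vu uF] cu; exists u.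
    by rewrite Fr // vu -val_eqE cu eqxx.
  case=> u /and3P[ur vu /eqP gu]; exists u; last by rewrite gu.
  by rewrite mem_filter vu; apply: rF ur (mem_head _ _) _; rewrite adj_sym.
case: ifP => // _.
have vF : v \notin F by apply/negP=> /Fr; rewrite mem_head.
have -> : val c :: [seq val (g u) | u <- F] =
          [seq val (recolor g v c u) | u <- v :: F].
  rewrite /= {1}/recolor eqxx; congr (_ :: _); apply/eq_in_map=> u uF.
  by rewrite /recolor; case: eqP vF => // <-; rewrite uF.
rewrite -map_mask lookup_tabulate ?size_map //; last first.
  by apply/allP=> _ /mapP[u _ ->]; apply: ltn_ord.
rewrite -filter_mask IHr //.
  move=> u; rewrite mem_filter inE => /andP[_ /predU1P[->//|/Fr]].
  by rewrite inE negb_or => /andP[].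
move=> u w ur wr uw; rewrite mem_filter inE; apply/andP; split; first by apply/hasP; exists w.
have [//|uv] := eqVneq u v.
by apply: rF uw; rewrite inE ?negb_or ?uv // wr orbT.
Qed.

Lemma num_colorings_count r : 0 < t -> uniq r -> (forall v, v \in r) ->
  num_colorings G t = nat_of_bin (count_completions [::] r [::]).
Proof.
move=> t0 Ur rT; pose g (_ : G) := Ordinal t0.
(* With no vertex coloured yet, the frontier is empty and the constant [g] constrains nothing. *)
rewrite (@count_completionsE [::] r g) //; last by move=> u v; rewrite rT.
apply: eq_card => f; rewrite [LHS]inE; apply/forallP/completionsP.
  move=> fP; split=> [x|u v _ uv]; first by rewrite rT.
  by move/forallP/(_ v)/implyP: (fP u); apply.
by case=> _ fP u; apply/forallP=> v; apply/implyP; apply: fP.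
Qed.

End Completions.

Definition west_to_east : seq G_A :=
  [:: CA; OR; WA; ID; NV; AZ; UT; WY; CO; NM; MT; NE; SD; ND; MN; IA; OK; KS;
      MO; TX; WI; AR; LA; IL; MI; MS; TN; KY; IN; OH; AL; FL; GA; NC; SC; VA;
      WV; MD; PA; DE; NJ; RI; NY; MA; CT; NH; VT; ME].

(** Frontiers of at most 6 states give tables of at most 4^6 = 4096 entries. *)
Lemma count_west_to_east :
  count_completions 4 [::] west_to_east [::] = 12811591729152%num.
Proof. by vm_compute. Qed.

Theorem mainTheorem4 : num_colorings G_A 4 = nat_of_bin 12811591729152%num.
Proof.
rewrite (@num_colorings_count _ _ west_to_east) ?count_west_to_east //.
by case.
Qed.
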